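(* Let $K_n$ be the complete graph on $n$ vertices, and let $S$, $C$, $\xi$ be the subgraph counting polynomial, the covered components polynomial and the edge elimination polynomial. (i) For all positive integers $a,b,c,\mu\in\mathbb{N}^{+}$, the sequences $n\mapsto S(K_n;a,b,c)$ and $n\mapsto C(K_n;a,b,c)$ are ultimately periodic modulo $\mu$. (ii) Let $a,b,c\in\mathbb{N}^{+}$ and assume that $ab$ divides $c$. Then, for every $\mu\in\mathbb{N}^{+}$, the sequence $n\mapsto \xi(K_n;a,b,c)$ is ultimately periodic modulo $\mu$.
   Context: Let $G=(V,E)$ be a finite simple graph. For a graph $H$, $\kappa(H)$ denotes the number of connected components of $H$ and $c(H)$ the number of connected components of $H$ that have at least one edge; for $A\subseteq E$ write $\kappa(A)=\kappa((V,A))$ and $c(A)=c((V,A))$. Subgraph counting polynomial: $S(G;X,Y,Z)=\sum_{H=(W,F)\subseteq G}X^{|W|}Y^{\kappa(H)}Z^{|F|}$, where $H$ ranges over all (not necessarily induced) subgraphs of $G$, i.e. $W\subseteq V$ and $F\subseteq E$ with all endpoints of edges in $F$ lying in $W$. Covered components polynomial: $C(G;X,Y,Z)=\sum_{A\subseteq E}X^{\kappa(A)}Y^{|A|}Z^{c(A)}$. Edge elimination polynomial: $\xi(G;X,Y,Z)=\sum_{(A\sqcup B)\subseteq E}X^{\kappa(A\sqcup B)-c(B)}\,Y^{|A|+|B|-c(B)}\,Z^{c(B)}$, where the sum is over all ordered pairs $(A,B)$ of subsets of $E$ such that the set of vertices covered by edges of $A$ and the set of vertices covered by edges of $B$ are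 disjoint, and $A\sqcup B$ denotes their union. An integer sequence $(s_n)_{n\ge 1}$ is ultimately periodic modulo $\mu$ if there exist $N\ge 1$ and $p\ge 1$ such that $s_{n+p}\equiv s_n \pmod{\mu}$ for all $n\ge N$. *)

(* Defs.v *)
From HB Require Import structures.
From mathcomp Require Import all_boot all_order all_algebra.
From mathcomp Require Import mpoly.

Set Implicit Arguments.
Unset Strict Implicit.
Unset Printing Implicit Defensive.

Import GRing.Theory.
Local Open Scope ring_scope.

Record sgraph := SGraph {
  vertex :> finType;
  adj : rel vertex;
  adj_sym : ssrbool.symmetric adj;
  adj_irr : irreflexive adj }.

Definition edges (G : sgraph) : {set {set G}} :=
  [set e | [exists x : G, exists y : G, adj x y && (e == [set x; y])]].

Lemma complete_sym n : ssrbool.symmetric (fun x y : 'I_n => x != y).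
Proof. by move=> x y; rewrite eq_sym. Qed.

Lemma complete_irr n : irreflexive (fun x y : 'I_n => x != y).
Proof. by move=> x; rewrite eqxx. Qed.

Definition complete (n : nat) : sgraph :=
  SGraph (@complete_sym n) (@complete_irr n).

Section Components.

Variable V : finType.
Implicit Types (W : {set V}) (F : {set {set V}}).

Definition edge_rel F : rel V := [rel x y | [set x; y] \in F].

(* For a set F of 2-element subsets of W: the vertex sets of the connected
   components of the graph (W, F). *)
Definition components W F : {set {set V}} :=
  equivalence_partition (connect (edge_rel F)) W.

Definition kappa W F : nat := #|components W F|.

Definition ncovered W F : nat :=
  #|[set K in components W F | [exists f in F, f \subset K]]|.

End Components.

Definition subgraph (G : sgraph) (H : {set G} * {set {set G}}) : bool :=
  (H.2 \subset edges G) && (cover H.2 \subset H.1).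

Notation varX := ('X_(@Ordinal 3 0 isT) : {mpoly int[3]}).
Notation varY := ('X_(@Ordinal 3 1 isT) : {mpoly int[3]}).
Notation varZ := ('X_(@Ordinal 3 2 isT) : {mpoly int[3]}).

Definition eval3 (p : {mpoly int[3]}) (a b c : int) : int :=
  p.@[tnth [tuple a; b; c]].

Definition subgraph_poly (G : sgraph) : {mpoly int[3]} :=
  \sum_(H : {set G} * {set {set G}} | subgraph H)
    varX ^+ #|H.1| * varY ^+ kappa H.1 H.2 * varZ ^+ #|H.2|.

Definition covered_poly (G : sgraph) : {mpoly int[3]} :=
  \sum_(A : {set {set G}} | A \subset edges G)
    varX ^+ kappa [set: G] A * varY ^+ #|A| * varZ ^+ ncovered [set: G] A.

(* The natural-number subtractions below never truncate: as A and B cover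
   disjoint vertex sets, each component of (V, B) containing an edge is also a
   component of (V, A :|: B), and it contains at least one edge of B. *)
Definition edge_elim_poly (G : sgraph) : {mpoly int[3]} :=
  \sum_(AB : {set {set G}} * {set {set G}} |
        [&& AB.1 \subset edges G, AB.2 \subset edges G
          & [disjoint cover AB.1 & cover AB.2]])
    let A := AB.1 in let B := AB.2 in
    let cB := ncovered [set: G] B in
    varX ^+ (kappa [set: G] (A :|: B) - cB)
      * varY ^+ (#|A| + #|B| - cB) * varZ ^+ cB.

Definition ultimately_periodic (s : nat -> int) (mu : nat) : Prop :=
  exists N p : nat, [/\ (0 < N)%N, (0 < p)%N &
    forall n : nat, (N <= n)%N -> (s (n + p)%N = s n %[mod mu%:Z])%Z].

(* Main.v *)
(** Write [c(F)] for the number of components of [F] with an edge. Each of the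
    three polynomials of [G], at the given point, is a sum over the edge sets [F]
    of [u^|F| x^(number of uncovered vertices) m^c(F) z^(number of covered
    vertices)] with [m] a natural number: [C(a,b,c)] has [x = a], [m = a c],
    [z = 1], [u = b]; [S(a,b,c)] has [x = 1 + a b], [m = b], [z = a], [u = c];
    and, summing over the ways to split the nontrivial components of [F]
    between [A] and [B], [xi(a,b,abd) = C(a,b,1+d)].

    Interpreting [m^c(F)] as a number of colourings and summing over [F] first
    turns this into the partition function of a spin model, which for the
    complete graph is a sum over [f : 'I_n -> T] of a product of vertex weights
    [w (f i)] and pair interactions [U (f i) (f j)]. Summing out the last vertex
    gives [Z_(n+1)(w) = sum_t w(t) Z_n(w * U(.,t))], so modulo [mu] the values
    [Z_n(w)], for all [w], are the successive states of a finite automaton. *)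
Require Import Defs.
From HB Require Import structures.
From mathcomp Require Import all_boot all_order all_algebra.
From mathcomp Require Import mpoly ring.

Set Implicit Arguments.
Unset Strict Implicit.
Unset Printing Implicit Defensive.

Import GRing.Theory.

Local Open Scope ring_scope.

(** * Components *)

Definition component (V : finType) (F : {set {set V}}) (x : V) : {set V} :=
  [set y | connect (edge_rel F) x y].

Definition nontrivial_components (V : finType) (F : {set {set V}}) :
  {set {set V}} := [set component F x | x in cover F].

Lemma edge_relE (V : finType) (F : {set {set V}}) (x y : V) :
  edge_rel F x y = ([set x; y] \in F).
Proof. by []. Qed.

Lemma edge_rel_sym (V : finType) (F : {set {set V}}) : connect_sym (edge_rel F).
Proof. by apply: sym_connect_sym => x y; rewrite !edge_relE setUC. Qed.

Lemma component_eq (V : finType) (F : {set {set V}}) (x y : V) :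
  (component F x == component F y) = connect (edge_rel F) x y.
Proof.
apply/eqP/idP => [E | xy].
  by have: y \in component F x by [rewrite E inE]; rewrite inE.
by apply/setP => z; rewrite !inE (same_connect (@edge_rel_sym _ F) xy).
Qed.

Lemma edge_rel_cover (V : finType) (F : {set {set V}}) (x y : V) :
  edge_rel F x y -> (x \in cover F) /\ (y \in cover F).
Proof.
move=> xyF; split; apply/bigcupP; exists [set x; y] => //.
  by rewrite set21.
by rewrite set22.
Qed.

Lemma connect_cover (V : finType) (F : {set {set V}}) (x y : V) :
  connect (edge_rel F) x y -> (x \in cover F) = (y \in cover F).
Proof. by apply: closed_connect => u v /edge_rel_cover[-> ->]. Qed.

Lemma component_uncovered (V : finType) (F : {set {set V}}) (x : V) :
  x \notin cover F -> component F x = [set x].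
Proof.
move=> xF; apply/setP => y; rewrite !inE.
apply/idP/eqP => [/connectP[[|z p] //= /andP[/edge_rel_cover[xF' _] _]] | -> //].
by rewrite xF' in xF.
Qed.

(** A walk from a vertex of [W] visits only that vertex and covered vertices, all in [W], so the
    intersection with [W] built into [equivalence_partition] removes nothing. *)
Lemma componentsE (V : finType) (W : {set V}) (F : {set {set V}}) :
  cover F \subset W -> components W F = [set component F x | x in W].
Proof.
move=> /subsetP FW; apply: eq_in_imset => x xW; apply/setP => y.
rewrite !inE; apply/andb_idl => xy.
have := connect_cover xy; case: (boolP (x \in _)) => xF yF.
  by apply: FW; rewrite -yF.
have: y \in component F x by rewrite inE.
by rewrite component_uncovered // => /set1P ->.
Qed.

Lemma edgesP (G : sgraph) (e : {set G}) :
  reflect (exists x y : G, adj x y /\ e = [set x; y]) (e \in edges G).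
Proof.
rewrite inE; apply: (iffP existsP) => [[x /existsP[y /andP[xy /eqP ->]]] | ].
  by exists x, y.
by case=> x [y [xy ->]]; exists x; apply/existsP; exists y; rewrite xy eqxx.
Qed.

Lemma edge_nonempty (G : sgraph) (e : {set G}) : e \in edges G -> exists x, x \in e.
Proof. by case/edgesP=> x [y [_ ->]]; exists x; rewrite set21. Qed.

Lemma edge_connect (G : sgraph) (F : {set {set G}}) (e : {set G}) (x y : G) :
  F \subset edges G -> e \in F -> x \in e -> y \in e ->
  connect (edge_rel F) x y.
Proof.
move=> /subsetP FG eF; have /edgesP[u [v [_ def_e]]] := FG _ eF.
have uv: connect (edge_rel F) u v by apply: connect1; rewrite edge_relE -def_e.
by rewrite def_e => /set2P[]-> /set2P[]->; rewrite ?connect0 // edge_rel_sym.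
Qed.

Lemma components_split (V : finType) (W : {set V}) (F : {set {set V}}) :
  cover F \subset W ->
  components W F = nontrivial_components F :|: [set [set x] | x in W :\: cover F].
Proof.
move=> FW; rewrite componentsE //.
rewrite -[in LHS](setID W (cover F)) (setIidPr FW) imsetU; congr (_ :|: _).
by apply: eq_in_imset => x /setDP[_]; apply: component_uncovered.
Qed.

Lemma singleton_notin_nontrivial (G : sgraph) (F : {set {set G}}) (x : G) :
  F \subset edges G -> [set x] \notin nontrivial_components F.
Proof.
move=> FG; apply/negP => /imsetP[y yF Exy].
have /set1P eq_yx : y \in [set x] by rewrite Exy inE connect0.
have /bigcupP[e eF ye] := yF.
have /edgesP[u [v [uv def_e]]] := subsetP FG _ eF.
have ux : u = x.
  by apply/set1P; rewrite Exy inE (edge_connect FG eF) // def_e set21.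
have vx : v = x.
  by apply/set1P; rewrite Exy inE (edge_connect FG eF) // def_e set22.
by rewrite ux vx adj_irr in uv.
Qed.

Lemma ncoveredE (G : sgraph) (W : {set G}) (F : {set {set G}}) :
  F \subset edges G -> cover F \subset W ->
  ncovered W F = #|nontrivial_components F|.
Proof.
move=> FG FW; congr #|pred_of_set _|; apply/setP => K; rewrite inE componentsE //.
apply/andP/imsetP => [[/imsetP[x xW ->] /existsP[e /andP[eF /subsetP eK]]] | ].
  have [y ye] := edge_nonempty (subsetP FG _ eF).
  exists x => //; have := eK _ ye; rewrite inE => /connect_cover ->.
  by apply/bigcupP; exists e.
case=> x xF ->; split; first by apply/imset_f/(subsetP FW).
have /bigcupP[e eF xe] := xF.
apply/existsP; exists e; rewrite eF; apply/subsetP => y ye.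
by rewrite inE (edge_connect FG eF).
Qed.

Lemma kappaE (G : sgraph) (W : {set G}) (F : {set {set G}}) :
  F \subset edges G -> cover F \subset W ->
  kappa W F = (#|nontrivial_components F| + #|W :\: cover F|)%N.
Proof.
move=> FG FW; rewrite /kappa components_split // cardsU.
rewrite (card_imset _ set1_inj) (_ : _ :&: _ = set0) ?cards0 ?subn0 //.
apply/setP => K; rewrite !inE; apply/andP => -[KF /imsetP[x _ def_K]].
by move: (singleton_notin_nontrivial x FG); rewrite -def_K KF.
Qed.

Lemma card_nontrivial_le (G : sgraph) (F : {set {set G}}) :
  F \subset edges G -> (#|nontrivial_components F| <= #|F|)%N.
Proof.
(* The vertices of an edge of [F] all have the same component, so this union is that component and
   no end of [e] has to be chosen. *)
move=> FG; pose h (e : {set G}) := \bigcup_(x in e) component F x.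
apply: leq_trans (leq_imset_card h _); apply/subset_leq_card/subsetP => K.
case/imsetP=> x /bigcupP[e eF xe] ->; apply/imsetP; exists e => //.
apply/eqP; rewrite eqEsubset (bigcup_sup x) //=; apply/bigcupsP => y ye.
have /eqP-> // : component F y == component F x.
by rewrite component_eq (edge_connect FG eF).
Qed.

(** A walk starting in [cover B] never takes an edge of [A], as that edge would put a vertex of
    [cover B] into [cover A]. *)
Lemma component_disjointU (G : sgraph) (A B : {set {set G}}) (x : G) :
  [disjoint cover A & cover B] -> x \in cover B ->
  component (A :|: B) x = component B x.
Proof.
move=> dAB xB; apply/setP => y; rewrite !inE; apply/idP/idP; last first.
  by apply: connect_sub => u v uvB; apply: connect1; rewrite edge_relE inE -!edge_relE uvB orbT.
case/connectP=> p; elim: p x xB => [|z p IHp] x xB /= => [_ -> // | /andP[xz zp] Ey].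
have xzB : [set x; z] \in B.
  case/setUP: xz => // xzA; have [xA _] := edge_rel_cover xzA.
  by rewrite (disjointFr dAB xA) in xB.
have [_ zB] := edge_rel_cover xzB.
by apply: connect_trans (IHp z zB zp Ey); apply: connect1.
Qed.

Lemma coverU (V : finType) (A B : {set {set V}}) :
  cover (A :|: B) = cover A :|: cover B.
Proof. exact: bigcup_setU. Qed.

Lemma nontrivial_disjointU (G : sgraph) (A B : {set {set G}}) :
  [disjoint cover A & cover B] ->
  nontrivial_components (A :|: B)
    = nontrivial_components A :|: nontrivial_components B.
Proof.
move=> dAB; rewrite /nontrivial_components coverU imsetU.
congr (_ :|: _); apply: eq_in_imset => x xF; last exact: component_disjointU.
by rewrite setUC component_disjointU // disjoint_sym.
Qed.

Lemma card_nontrivial_disjointU (G : sgraph) (A B : {set {set G}}) :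
  [disjoint cover A & cover B] ->
  #|nontrivial_components (A :|: B)|
    = (#|nontrivial_components A| + #|nontrivial_components B|)%N.
Proof.
move=> dAB; rewrite nontrivial_disjointU // cardsU.
rewrite (_ : _ :&: _ = set0) ?cards0 ?subn0 //.
apply/setP => K; rewrite !inE; apply/andP => -[/imsetP[x xA ->] /imsetP[y yB E]].
have: y \in component A x by rewrite E inE connect0.
by rewrite inE => /connect_cover; rewrite xA (disjointFl dAB yB).
Qed.

Lemma edge_sets_disjoint (G : sgraph) (A B : {set {set G}}) :
  A \subset edges G -> [disjoint cover A & cover B] -> [disjoint A & B].
Proof.
move=> AG dAB; rewrite -setI_eq0; apply/eqP/setP => e; rewrite !inE.
apply/andP => -[eA eB]; have [x xe] := edge_nonempty (subsetP AG _ eA).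
have xA : x \in cover A by apply/bigcupP; exists e.
have xB : x \in cover B by apply/bigcupP; exists e.
by rewrite (disjointFr dAB xA) in xB.
Qed.

(** * Edge sets and colourings *)

Lemma sum_exp_subset (R : comNzRingType) (T : finType) (D : {set T}) (y : R) :
  \sum_(S : {set T} | S \subset D) y ^+ #|S| = (1 + y) ^+ #|D|.
Proof.
have -> : (1 + y) ^+ #|D| = \prod_i ((if i \in D then y else 0) + 1).
  rewrite -prodr_const big_mkcond; apply: eq_bigr => i _.
  by case: ifP; rewrite ?add0r // addrC.
rewrite bigA_distr [LHS]big_mkcond; apply: eq_bigr => S _.
case: ifPn => [/subsetP SD | /subsetPn[i iS /negPf iD]].
  rewrite -prodr_const big_mkcond; apply: eq_bigr => i _.
  by case: ifP => // iS; rewrite (SD _ iS).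
by rewrite (bigD1 i) //= iS iD mul0r.
Qed.

(** * Splitting an edge set along its nontrivial components *)

Definition edges_within (V : finType) (F S : {set {set V}}) : {set {set V}} :=
  [set e in F | e \subset cover S].

(** An edge of [F] that meets a member [K] of [S] lies inside the component [K], hence is kept by
    [edges_within]. *)
Lemma edges_within_disjoint (G : sgraph) (F S : {set {set G}}) :
  F \subset edges G -> S \subset nontrivial_components F ->
  [disjoint cover (F :\: edges_within F S) & cover (edges_within F S)].
Proof.
move=> FG SF; rewrite -setI_eq0; apply/eqP/setP => x; rewrite !inE.
apply/andP => -[/bigcupP[e + xe] /bigcupP[e' + xe']].
rewrite !inE => /andP[+ eF] /andP[e'F /subsetP/(_ _ xe')/bigcupP[K KS xK]].
rewrite eF /= => /negP; apply; apply: subset_trans (bigcup_sup K KS).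
have /imsetP[z zF def_K] := subsetP SF _ KS; apply/subsetP => y ye.
move: xK; rewrite def_K !inE => /connect_trans; apply.
exact: edge_connect FG eF xe ye.
Qed.

Lemma edges_within_sub (V : finType) (F S : {set {set V}}) :
  edges_within F S \subset F.
Proof. by apply/subsetP => e; rewrite inE => /andP[]. Qed.

Lemma setDUsub (T : finType) (A B : {set T}) : B \subset A -> A :\: B :|: B = A.
Proof. by move=> BA; rewrite setUC -{1}(setIidPr BA) setID. Qed.

Lemma nontrivial_edges_within (G : sgraph) (F S : {set {set G}}) :
  F \subset edges G -> S \subset nontrivial_components F ->
  nontrivial_components (edges_within F S) = S.
Proof.
move=> FG SF; have dF := edges_within_disjoint FG SF.
have defF := setDUsub (edges_within_sub F S).
apply/setP => K; apply/imsetP/idP => [[x xB ->] | KS].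
  rewrite -(component_disjointU dF xB) defF.
  have /bigcupP[e + xe] := xB; rewrite inE => /andP[_ /subsetP/(_ _ xe)].
  case/bigcupP=> L LS; have /imsetP[z _ defL] := subsetP SF _ LS.
  by rewrite defL inE -component_eq => /eqP <-; rewrite -defL.
have /imsetP[x xF defK] := subsetP SF _ KS.
have xB: x \in cover (edges_within F S).
  have /bigcupP[e eF xe] := xF; apply/bigcupP; exists e => //.
  rewrite inE eF /=; apply: subset_trans (bigcup_sup K KS).
  by apply/subsetP => y ye; rewrite defK inE (edge_connect FG eF).
by exists x; rewrite // -(component_disjointU dF xB) defF.
Qed.

Lemma cover_nontrivial (V : finType) (F : {set {set V}}) :
  cover (nontrivial_components F) = cover F.
Proof.
apply/setP => x; apply/bigcupP/idP => [[K /imsetP[y yF ->]] | xF].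
  by rewrite inE => /connect_cover <-.
by exists (component F x); [apply: imset_f | rewrite inE connect0].
Qed.

(** An admissible [B] takes all or none of the edges of each component of [F], so
    [nontrivial_components] and [edges_within] match these [B] with the subsets of
    [nontrivial_components F], and the sum is a binomial expansion. *)
Lemma sum_split_nontrivial (R : comNzRingType) (G : sgraph) (F : {set {set G}})
    (d : R) :
  F \subset edges G ->
  \sum_(B : {set {set G}} |
      (B \subset F) && [disjoint cover (F :\: B) & cover B])
    d ^+ #|nontrivial_components B| = (1 + d) ^+ #|nontrivial_components F|.
Proof.
move=> FG; rewrite -sum_exp_subset.
rewrite [RHS](reindex_onto (@nontrivial_components _) (edges_within F)) /=; last first.
  by move=> S; apply: nontrivial_edges_within.
apply: eq_bigl => B; apply/andP/andP => [[BF dB] | [BF /eqP defB]]; last first.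
  by rewrite -defB edges_within_sub edges_within_disjoint.
split.
  by have := nontrivial_disjointU dB; rewrite setDUsub // => ->; apply: subsetUr.
apply/eqP/setP => e; rewrite inE cover_nontrivial; apply/andP/idP => [[eF eB] | eB].
  apply: contraT => eNB; have [x xe] := edge_nonempty (subsetP FG _ eF).
  have xA: x \in cover (F :\: B) by apply/bigcupP; exists e; rewrite // inE eNB.
  by have := subsetP eB _ xe; rewrite (disjointFr dB xA).
by split; [apply: (subsetP BF) | apply: (bigcup_sup e)].
Qed.

(** A function constant along edges is a function on the set of components; distributivity then
    gives a product over components of sums over their common value. *)
Lemma sum_component_constant (R : comNzRingType) (V T : finType) (t0 : T)
    (F : {set {set V}}) (w : V -> T -> R) :
  \sum_(f : {ffun V -> T} |
      [forall x, forall y, edge_rel F x y ==> (f x == f y)]) \prod_x w x (f x)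
  = \prod_(K in [set component F x | x in [set: V]])
      \sum_t \prod_(x | component F x == K) w x t.
Proof.
pose h (g : {ffun {set V} -> T}) : {ffun V -> T} := [ffun x => g (component F x)].
(* [big_distr_big] ranges over functions equal to [t0] off the set of components, hence this default
   value. *)
pose h' (f : {ffun V -> T}) : {ffun {set V} -> T} := [ffun K : {set V} =>
  if [pick x | component F x == K] is Some x then f x else t0].
rewrite (big_distr_big t0) (reindex_onto h h') /=; last first.
  move=> f /forallP f_const; apply/ffunP => x; rewrite !ffunE.
  case: pickP => [y | /(_ x)]; last by rewrite eqxx.
  rewrite component_eq => yx.
  have cl : closed (edge_rel F) [pred z | f z == f x].
    by move=> u v uv; have /forallP/(_ v)/implyP/(_ uv)/eqP := f_const u; rewrite !inE => ->.
  by have := closed_connect cl yx; rewrite !inE eqxx => /eqP.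
apply: eq_big => [g | g _].
  have -> : [forall x, forall y, edge_rel F x y ==> (h g x == h g y)].
    apply/forallP => x; apply/forallP => y; apply/implyP => xy; rewrite !ffunE.
    by apply/eqP; congr (g _); apply/eqP; rewrite component_eq connect1.
  apply/eqP/pffun_onP => [<- | [/subsetP gP _]].
    split=> //; apply/subsetP => K; rewrite !inE ffunE.
    case: pickP => [x /eqP <- _ | _]; first exact: imset_f.
    by rewrite eqxx.
  apply/ffunP => K; rewrite ffunE; case: pickP => [x /eqP <- | noK]; first by rewrite ffunE.
  apply/esym/eqP/contraT => /gP/imsetP[x _ defK].
  by have := noK x; rewrite defK eqxx.
transitivity (\prod_(x in [set: V]) w x (h g x)).
  by apply: eq_bigl => x; rewrite in_setT.
rewrite (partition_big_imset (component F)) /=; apply: eq_bigr => K _.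
apply: eq_big => [x | x /andP[_ /eqP <-]]; first by rewrite inE.
by rewrite ffunE.
Qed.

(** Edges with both ends [None] are excluded: a set [F] of edges lies in [monochromatic f] exactly
    when [f] gives each component of [F] with edges a single colour [Some t]. *)
Definition monochromatic (G : sgraph) (m : nat) (f : {ffun G -> option 'I_m}) :
    {set {set G}} :=
  [set e in edges G | [exists t, forall x in e, f x == Some t]].

(** The weight of [None] completes the total weight of the [m + 1] colours to [x]. *)
Definition colour_weight (R : comNzRingType) (m : nat) (x z : R)
  (t : option 'I_m) : R := if t is Some _ then z else x - m%:R * z.

Lemma prod_setU (R : comNzRingType) (T : finType) (A B : {set T}) (g : T -> R) :
  [disjoint A & B] ->
  \prod_(i in A :|: B) g i = \prod_(i in A) g i * \prod_(i in B) g i.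
Proof. by move=> dAB; rewrite -bigU //; apply: eq_bigl => i; rewrite !inE. Qed.

Lemma sum_option (R : comNzRingType) (T : finType) (g : option T -> R) :
  \sum_t g t = g None + \sum_i g (Some i).
Proof.
rewrite (bigD1 None) //=; congr (_ + _).
rewrite (reindex_omap Some id) => [|[]//]; apply: eq_bigl => i.
by rewrite /= eqxx.
Qed.

(* An uncovered vertex may take any colour, for a total weight [x], whereas the
   vertices of a component with edges share one of the [m] colours [Some t]. *)
Lemma sum_colourings (R : comNzRingType) (G : sgraph) (m : nat) (x z : R)
    (F : {set {set G}}) : F \subset edges G ->
  \sum_(f : {ffun G -> option 'I_m} | F \subset monochromatic f)
     \prod_v colour_weight x z (f v)
  = x ^+ #|~: cover F| * m%:R ^+ #|nontrivial_components F| * z ^+ #|cover F|.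
Proof.
move=> FG.
(* Giving [None] weight 0 on covered vertices replaces [F \subset monochromatic f] by mere constancy
   of [f] along the edges of [F]. *)
pose w v (t : option 'I_m) : R :=
  if v \in cover F then (if t is Some _ then z else 0) else colour_weight x z t.
have -> : \sum_(f : {ffun G -> option 'I_m} | F \subset monochromatic f)
     \prod_v colour_weight x z (f v) = \sum_(f : {ffun G -> option 'I_m} |
      [forall x, forall y, edge_rel F x y ==> (f x == f y)]) \prod_v w v (f v).
  rewrite [LHS]big_mkcond [RHS]big_mkcond; apply: eq_bigr => f _.
  case: ifPn => [/subsetP Ff | /subsetPn[e eF]].
    rewrite ifT; last first.
      apply/forallP => u; apply/forallP => v; apply/implyP => /Ff.
      rewrite inE => /andP[_ /existsP[t /forall_inP ft]].
      by rewrite (eqP (ft u _)) ?(eqP (ft v _)) ?set21 ?set22.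
    apply: eq_bigr => v _; rewrite /w; case: ifP => // /bigcupP[e /Ff].
    rewrite inE => /andP[_ /existsP[t /forall_inP ft]] /ft/eqP -> //.
  have eG := subsetP FG _ eF; rewrite inE eG /=.
  have /edgesP[u [v [_ def_e]]] := eG => f_e; case: ifP => // /forallP/(_ u)/forallP/(_ v).
  rewrite edge_relE -def_e eF /= => /eqP f_uv.
  (* The ends of [e] agree although [e] is not monochromatic, so their value is [None] and the
     factor at [u] vanishes. *)
  have f_u : f u = None.
    case f_u: (f u) => [t|] //; case/existsP: f_e; exists t.
    by apply/forall_inP => y; rewrite def_e => /set2P[]->; rewrite -?f_uv f_u.
  rewrite (bigD1 u) //= /w f_u ifT ?mul0r //.
  by apply/bigcupP; exists e; rewrite // def_e set21.
rewrite (sum_component_constant None) -(setUCr (cover F)) imsetU prod_setU; last first.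
  rewrite -setI_eq0; apply/eqP/setP => K; rewrite !inE.
  apply/andP => -[/imsetP[u uF ->] /imsetP[v vF /eqP]].
  by rewrite component_eq => /connect_cover; rewrite uF; move: vF; rewrite inE => /negPf->.
rewrite mulrC -[RHS]mulrA; congr (_ * _).
  (* An uncovered vertex is its own component and contributes [(x - m z) + m z = x]. *)
  rewrite big_imset /=; last first.
    move=> u v; rewrite inE => uF _ Euv.
    by apply/esym/set1P; rewrite -(component_uncovered uF) Euv inE connect0.
  rewrite -prodr_const; apply: eq_bigr => v; rewrite inE => vF.
  rewrite sum_option /=.
  have inv (t : option 'I_m) :
      \prod_(u | component F u == component F v) w u t = colour_weight x z t.
    rewrite (big_pred1 v) => [|u]; first by rewrite /w (negPf vF).
    rewrite component_eq edge_rel_sym.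
    by have := component_uncovered vF => /setP/(_ u); rewrite !inE.
  rewrite inv (eq_bigr (fun=> z)) => [|i _]; last exact: inv.
  by rewrite sumr_const card_ord -mulr_natl subrK.
rewrite -!prodr_const (partition_big_imset (component F)) -big_split /=.
apply: eq_bigr => K /imsetP[y yF ->].
have inF v : component F v == component F y -> v \in cover F.
  by rewrite component_eq => /connect_cover ->.
rewrite sum_option (bigD1 y) //= {1}/w yF mul0r add0r.
rewrite (eq_bigr (fun=> \prod_(v in cover F | component F v == component F y) z)).
  by rewrite sumr_const card_ord mulr_natl.
move=> i _; apply: eq_big => [v | v /inF vF]; last by rewrite /w vF.
by apply/idP/andP => [vy | []//]; split=> //; apply: inF.
Qed.

(** For a fixed colouring, the edge sets allowed are the subsets of [monochromatic f], over which
    [u ^+ #|F|] sums to a power of [1 + u]. *)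
Lemma sum_edge_sets (R : comNzRingType) (G : sgraph) (m : nat) (x z u : R) :
  \sum_(F : {set {set G}} | F \subset edges G)
    u ^+ #|F| * (x ^+ #|~: cover F| * m%:R ^+ #|nontrivial_components F|
                 * z ^+ #|cover F|)
  = \sum_(f : {ffun G -> option 'I_m})
      (1 + u) ^+ #|monochromatic f| * \prod_v colour_weight x z (f v).
Proof.
under eq_bigr => F FG do rewrite -sum_colourings // mulr_sumr.
rewrite (exchange_big_dep xpredT) //=; apply: eq_bigr => f _.
rewrite -mulr_suml -sum_exp_subset; congr (_ * _); apply: eq_bigl => F.
apply: andb_idl => /subset_trans; apply; apply/subsetP => e.
by rewrite inE => /andP[].
Qed.

(** * Spin models on complete graphs *)

(** The weight [w] varies along the recursion because the interactions of the spin summed out are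
    absorbed into the weights of the others. *)
Fixpoint spin_sum (R : comNzRingType) (T : finType) (U : T -> T -> R) (n : nat)
    (w : T -> R) : R :=
  if n is k.+1 then \sum_t w t * spin_sum U k (fun s => w s * U s t) else 1.

Lemma eq_spin_sum (R : comNzRingType) (T : finType) (U : T -> T -> R) (n : nat)
    (w1 w2 : T -> R) :
  w1 =1 w2 -> spin_sum U n w1 = spin_sum U n w2.
Proof.
elim: n w1 w2 => //= n IHn w1 w2 w12; apply: eq_bigr => t _.
by rewrite w12; congr (_ * _); apply: IHn => s; rewrite w12.
Qed.

Lemma rmorph_spin_sum (R S : comNzRingType) (phi : {rmorphism R -> S})
    (T : finType) (U : T -> T -> R) (n : nat) (w : T -> R) :
  phi (spin_sum U n w) = spin_sum (fun s t => phi (U s t)) n (phi \o w).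
Proof.
elim: n w => /= [|n IHn] w; first exact: rmorph1.
rewrite rmorph_sum; apply: eq_bigr => t _; rewrite rmorphM IHn; congr (_ * _).
by apply: eq_spin_sum => s /=; rewrite rmorphM.
Qed.

Lemma spin_sumE (R : comNzRingType) (T : finType) (U : T -> T -> R) (n : nat)
    (w : T -> R) :
  \sum_(f : {ffun 'I_n -> T})
    (\prod_(j < n) \prod_(i < n) if (i < j)%N then U (f i) (f j) else 1)
      * \prod_i w (f i)
  = spin_sum U n w.
Proof.
elim: n w => /= [|n IHn] w.
  under eq_bigr => f _ do rewrite !big_ord0 mulr1.
  by rewrite sumr_const card_ffun card_ord expn0.
(* A colouring of [n + 1] vertices is the colour of [ord_max] together with a colouring of the
   others. *)
pose h (p : T * {ffun 'I_n -> T}) : {ffun 'I_n.+1 -> T} :=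
  [ffun i => if unlift ord_max i is Some j then p.2 j else p.1].
pose h' (f : {ffun 'I_n.+1 -> T}) : T * {ffun 'I_n -> T} :=
  (f ord_max, [ffun j => f (lift ord_max j)]).
have h_max p : h p ord_max = p.1 by rewrite ffunE unlift_none.
have h_lift p j : h p (lift ord_max j) = p.2 j by rewrite ffunE liftK.
have h_widen p j : h p (widen_ord (leqnSn n) j) = p.2 j.
  by rewrite -h_lift; congr (h p _); apply: ord_inj; rewrite lift_max.
rewrite (reindex h) /=; last first.
  exists h' => [[t g] _ | f _].
    by rewrite /h' h_max; congr pair; apply/ffunP => j; rewrite ffunE h_lift.
  apply/ffunP => i; rewrite [LHS]ffunE; case: unliftP => [j|] -> //=.
  by rewrite ffunE.
under [RHS]eq_bigr => t _ do rewrite -IHn mulr_sumr.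
rewrite pair_big; apply: eq_bigr => -[t g] _ /=.
rewrite !big_ord_recr /= ltnn mulr1 h_max /= -!mulrA [RHS]mulrC -!mulrA.
under [X in _ * (X * _)]eq_bigr => i _ do rewrite ltn_ord h_widen.
under [X in _ * (_ * (X * _))]eq_bigr => i _ do rewrite h_widen.
rewrite big_split /= -!mulrA; congr (_ * _); last by rewrite mulrCA.
(* The last vertex is never the smaller end of a pair, so it contributes 1 to the rows [j < n]. *)
apply: eq_bigr => j _; rewrite big_ord_recr /= ltnNge ltnW ?ltn_ord // mulr1.
by apply: eq_bigr => i _; rewrite !h_widen.
Qed.

(** * Periodicity over finite rings and modulo [mu] *)

Lemma iter_ultimately_periodic (S : finType) (phi : S -> S) (s : S) :
  exists N p : nat, (0 < p)%N /\
    forall n : nat, (N <= n)%N -> iter (n + p) phi s = iter n phi s.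
Proof.
(* Iterate number [order phi s] repeats an earlier iterate [i]; the difference is a period from [i]
   on. *)
have /trajectP[i lt_i E] := looping_order phi s.
exists i, (order phi s - i)%N; split=> [|n le_in]; first by rewrite subn_gt0.
rewrite -(subnK le_in) -addnA subnKC ?(ltnW lt_i) //.
by rewrite iterD E -iterD.
Qed.

(* Since [U] does not depend on [n], the family of all the values
   [spin_sum U n w], for [w] ranging over the finite set of weight functions,
   is obtained from the previous one by a fixed map on a finite set. *)
Lemma spin_sum_ultimately_periodic (R : finComNzRingType) (T : finType)
    (U : T -> T -> R) (w : T -> R) :
  exists N p : nat, (0 < p)%N /\
    forall n : nat, (N <= n)%N -> spin_sum U (n + p) w = spin_sum U n w.
Proof.
pose phi (v : {ffun {ffun T -> R} -> R}) : {ffun {ffun T -> R} -> R} :=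
  [ffun w : {ffun T -> R} => \sum_t w t * v [ffun s => w s * U s t]].
have phiE n (v : {ffun T -> R}) : iter n phi [ffun=> 1] v = spin_sum U n v.
  elim: n v => [|n IHn] v /=; rewrite ffunE //; apply: eq_bigr => t _.
  by rewrite IHn; congr (_ * _); apply: eq_spin_sum => s; rewrite ffunE.
have [N [p [p_gt0 per]]] := iter_ultimately_periodic phi [ffun=> 1].
exists N, p; split=> // n le_Nn.
have wE k : spin_sum U k w = spin_sum U k [ffun t => w t].
  by apply: eq_spin_sum => t; rewrite ffunE.
by rewrite !wE -!phiE per.
Qed.

(** The remainder of [x - y] is at least 0, below [mu], and zero in ['Z_mu], hence zero. *)
Lemma intr_Zp_eq (mu : nat) (x y : int) : (1 < mu)%N ->
  x%:~R = y%:~R :> 'Z_mu -> (x = y %[mod mu%:Z])%Z.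
Proof.
move=> mu_gt1 /eqP; rewrite -subr_eq0 -rmorphB /= => /eqP xy.
apply/eqP; rewrite eqz_mod_dvd; apply/dvdzP.
move: xy; rewrite {1}(divz_eq (x - y) mu) rmorphD rmorphM /=.
have -> : mu%:~R = 0 :> 'Z_mu by exact: pchar_Zp.
rewrite mulr0 add0r => xy; exists ((x - y) %/ mu)%Z.
rewrite {1}(divz_eq (x - y) mu).
have : (0 <= (x - y) %% mu)%Z by rewrite modz_ge0 // -lt0n ltnW.
have : ((x - y) %% mu < mu)%Z by rewrite ltz_pmod // ltz_nat ltnW.
case: (modz _ _) xy => // k /(congr1 val) /=; rewrite val_Zp_nat // => + k_lt _.
by rewrite modn_small // => ->; rewrite addr0.
Qed.

Lemma colour_sum_complete (R : comNzRingType) (n m : nat) (u : R)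
    (f : {ffun complete n -> option 'I_m}) :
  (1 + u) ^+ #|monochromatic f| = \prod_(j < n) \prod_(i < n)
     if (i < j)%N then (if (f i == f j) && (f i != None) then 1 + u else 1) else 1.
Proof.
(* Each edge is recorded once, larger end first, following the index order of the double product. *)
pose D := [set p : 'I_n * 'I_n |
  (p.2 < p.1)%N && ((f p.2 == f p.1) && (f p.2 != None))].
pose e (p : 'I_n * 'I_n) : {set complete n} := [set p.2; p.1].
have -> : monochromatic f = e @: D.
  apply/setP => E; apply/idP/imsetP.
    rewrite inE => /andP[/edgesP[x [y [xy ->]]] /existsP[t /forall_inP ft]].
    have [fx fy] : f x = Some t /\ f y = Some t.
      by split; apply/eqP/ft; rewrite ?set21 ?set22.
    case: (ltngtP x y) => [lt_xy | lt_yx | /ord_inj eq_xy].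
    - by exists (y, x); rewrite // inE /= lt_xy fx fy eqxx.
    - by exists (x, y); rewrite ?inE /= ?lt_yx ?fx ?fy ?eqxx // /e setUC.
    - by move: xy; rewrite /= eq_xy eqxx.
  case=> -[y x]; rewrite inE /= => /andP[xy /andP[/eqP fxy fx]] ->.
  rewrite inE; apply/andP; split.
    by apply/edgesP; exists x, y; split=> //=; rewrite neq_ltn xy.
  case fx': (f x) fx => [t|] // _; apply/existsP; exists t.
  by apply/forall_inP => z /set2P[]->; rewrite -?fxy fx'.
rewrite card_in_imset => [|[y x] [y' x']]; last first.
  rewrite !inE /= => /andP[xy _] /andP[xy' _] /setP E.
  have := E x; have := E y; rewrite !inE !eqxx orbT => /esym y_in /esym x_in.
  case/orP: x_in => /eqP xE; case/orP: y_in => /eqP yE.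
  - by rewrite xE yE ltnn in xy.
  - by rewrite xE yE.
  - by rewrite xE yE ltnNge ltnW in xy.
  - by rewrite xE yE ltnn in xy.
rewrite -prodr_const big_mkcond pair_big; apply: eq_bigr => -[j i] _ /=.
by rewrite inE /=; case: (i < j)%N.
Qed.

Lemma colour_sum_ultimately_periodic (m mu : nat) (x z u : int) : (0 < mu)%N ->
  ultimately_periodic (fun n => \sum_(f : {ffun complete n -> option 'I_m})
      (1 + u) ^+ #|monochromatic f| * \prod_v colour_weight x z (f v)) mu.
Proof.
(* ['Z_1] has two elements, so modulus 1 is settled apart. *)
rewrite leq_eqVlt => /predU1P[<- | mu_gt1].
  by exists 1%N, 1%N; split=> // n _; rewrite !modz1.
pose U (s t : option 'I_m) := if (s == t) && (s != None) then 1 + u else 1.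
pose w : option 'I_m -> int := colour_weight x z.
have [N [p [p_gt0 per]]] := spin_sum_ultimately_periodic
  (fun s t => (U s t)%:~R : 'Z_mu) (fun t => (w t)%:~R).
exists N.+1, p; split=> // n /ltnW /per.
have E k : \sum_(f : {ffun complete k -> option 'I_m})
    (1 + u) ^+ #|monochromatic f| * \prod_v colour_weight x z (f v)
    = spin_sum U k w.
  rewrite -spin_sumE; apply: eq_bigr => f _.
  by rewrite colour_sum_complete.
rewrite !E => /esym per_n; apply: intr_Zp_eq => //.
by rewrite !(rmorph_spin_sum (intmul 1)).
Qed.

(** * The three polynomials *)

Lemma eval3_monomial (a b c : int) (i j k : nat) :
  (varX ^+ i * varY ^+ j * varZ ^+ k).@[tnth [tuple a; b; c]]
  = a ^+ i * b ^+ j * c ^+ k.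
Proof. by rewrite !mevalM !rmorphXn /= !mevalXU. Qed.

Lemma eval3_subgraph_poly (G : sgraph) (a b c : int) :
  eval3 (subgraph_poly G) a b c =
  \sum_(H : {set G} * {set {set G}} | subgraph H)
    a ^+ #|H.1| * b ^+ kappa H.1 H.2 * c ^+ #|H.2|.
Proof.
rewrite /eval3 rmorph_sum; apply: eq_bigr => H _; exact: eval3_monomial.
Qed.

Lemma eval3_covered_poly (G : sgraph) (a b c : int) :
  eval3 (covered_poly G) a b c =
  \sum_(A : {set {set G}} | A \subset edges G)
    a ^+ kappa [set: G] A * b ^+ #|A| * c ^+ ncovered [set: G] A.
Proof.
rewrite /eval3 rmorph_sum; apply: eq_bigr => A _; exact: eval3_monomial.
Qed.

Lemma eval3_edge_elim_poly (G : sgraph) (a b c : int) :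
  eval3 (edge_elim_poly G) a b c =
  \sum_(AB : {set {set G}} * {set {set G}} |
        [&& AB.1 \subset edges G, AB.2 \subset edges G
          & [disjoint cover AB.1 & cover AB.2]])
    a ^+ (kappa [set: G] (AB.1 :|: AB.2) - ncovered [set: G] AB.2)
      * b ^+ (#|AB.1| + #|AB.2| - ncovered [set: G] AB.2)
      * c ^+ ncovered [set: G] AB.2.
Proof.
rewrite /eval3 rmorph_sum; apply: eq_bigr => AB _; exact: eval3_monomial.
Qed.

(** A component with edges gets a factor [a] from [kappa] and a factor [c] from [ncovered], hence
    [a * c] colours; an uncovered vertex only counts in [kappa], hence weight [a]. *)
Lemma covered_poly_colourings (G : sgraph) (a c : nat) (b : int) :
  eval3 (covered_poly G) a b c = \sum_(f : {ffun G -> option 'I_(a * c)})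
    (1 + b) ^+ #|monochromatic f| * \prod_v colour_weight a%:Z 1 (f v).
Proof.
rewrite eval3_covered_poly -sum_edge_sets; apply: eq_bigr => F FG.
rewrite ncoveredE ?kappaE ?subsetT // setTD expr1n natz PoszM.
rewrite exprD exprMn; do ?[move: (_ ^+ _) => ?]; ring.
Qed.

(** For fixed [F], the set [W] is [cover F] plus a free choice of isolated vertices: an uncovered
    vertex is absent, with factor 1, or a component of its own, with factor [a * b]. *)
Lemma subgraph_poly_colourings (G : sgraph) (b : nat) (a c : int) :
  eval3 (subgraph_poly G) a b c = \sum_(f : {ffun G -> option 'I_b})
    (1 + c) ^+ #|monochromatic f| * \prod_v colour_weight (1 + a * b%:Z) a (f v).
Proof.
rewrite eval3_subgraph_poly -sum_edge_sets.
transitivity (\sum_(F : {set {set G}} | F \subset edges G)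
    \sum_(W : {set G} | cover F \subset W)
      a ^+ #|W| * b%:Z ^+ kappa W F * c ^+ #|F|).
  pose swap (S T : finType) (p : S * T) := (p.2, p.1).
  rewrite pair_big_dep (reindex_onto (@swap _ _) (@swap _ _)) /=; last by case.
  by apply: eq_bigl => -[F W]; rewrite eqxx andbT.
apply: eq_bigr => F FG; rewrite -sum_exp_subset.
rewrite (reindex_onto (fun U => cover F :|: U) (fun W => W :\: cover F)) /=; last first.
  by move=> W FW; rewrite setUC setDUsub.
rewrite mulr_suml mulr_suml mulr_sumr; apply: eq_big => [U | U].
  rewrite subsetUl setDUl setDv set0U; apply/eqP/idP => [<- | ].
    by rewrite setDE subsetIr.
  by rewrite -disjoints_subset => /setDidPl.
have FU := subsetUl (cover F) U.
rewrite kappaE // -(cardsID (cover F) (_ :|: U)) (setIidPr FU).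
rewrite setDUl setDv set0U => /andP[_ /eqP ->].
rewrite natz !exprD exprMn; do ?[move: (_ ^+ _) => ?]; ring.
Qed.

(** The power of [a * b] in the third argument restores the exponents reduced by [c(B)] and leaves
    [d ^ c(B)]; summing over the splittings of [F] into [A] and [B] gives [(1 + d) ^ c(F)]. *)
Lemma edge_elim_poly_covered (G : sgraph) (a b d : int) :
  eval3 (edge_elim_poly G) a b (a * b * d) = eval3 (covered_poly G) a b (1 + d).
Proof.
rewrite eval3_edge_elim_poly eval3_covered_poly.
pose P (F B : {set {set G}}) :=
  (B \subset F) && [disjoint cover (F :\: B) & cover B].
transitivity (\sum_(F : {set {set G}} | F \subset edges G) \sum_(B | P F B)
    a ^+ kappa [set: G] F * b ^+ #|F| * d ^+ #|nontrivial_components B|); last first.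
  apply: eq_bigr => F FG; rewrite ncoveredE ?subsetT //.
  by rewrite -sum_split_nontrivial // mulr_sumr.
rewrite pair_big_dep.
rewrite [RHS](reindex_onto (fun p => (p.1 :|: p.2, p.2)) (fun p => (p.1 :\: p.2, p.2))) /=.
  apply: eq_big => [[A B] | [A B]] /=.
    rewrite subUset /P subsetUr setDUl setDv setU0 /=.
    apply/and3P/andP => [[AG BG dAB] | ].
      by rewrite AG BG (setDidPl (edge_sets_disjoint AG dAB)) dAB.
    by case=> /andP[/andP[-> ->] dAB] /eqP[defA]; rewrite defA in dAB.
  case/and3P=> AG BG dAB.
  have ABG : A :|: B \subset edges G by rewrite subUset AG.
  rewrite ncoveredE ?kappaE ?subsetT // //.
  have -> : (#|A| + #|B|)%N = #|A :|: B|.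
    by apply/esym/eqP; rewrite (leq_card_setU A B).2 edge_sets_disjoint.
  (* With at least as many edges in [B] as nontrivial components, the subtraction in the exponent of
     [b] is exact. *)
  have le_B := leq_trans (card_nontrivial_le BG) (subset_leq_card (subsetUr A B)).
  rewrite card_nontrivial_disjointU // addnAC addnK.
  rewrite -{2}(subnK le_B) !exprMn !exprD; do ?[move: (_ ^+ _) => ?]; ring.
by case=> F B /andP[_ /andP[BF _]] /=; rewrite setDUsub.
Qed.

Lemma eq_ultimately_periodic (s1 s2 : nat -> int) (mu : nat) :
  s1 =1 s2 -> ultimately_periodic s1 mu -> ultimately_periodic s2 mu.
Proof.
move=> s12 [N [p [N_gt0 p_gt0 per]]]; exists N, p; split=> // n Nn.
by rewrite -!s12 per.
Qed.

Lemma covered_poly_periodic (a b c mu : nat) : (0 < mu)%N ->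
  ultimately_periodic
    (fun n => eval3 (covered_poly (complete n)) (Posz a) (Posz b) (Posz c)) mu.
Proof.
move=> mu_gt0; apply: eq_ultimately_periodic.
  by move=> n; rewrite covered_poly_colourings.
exact: colour_sum_ultimately_periodic.
Qed.

Theorem theorem1p6 :
  (forall a b c mu : nat,
     (0 < a)%N -> (0 < b)%N -> (0 < c)%N -> (0 < mu)%N ->
     ultimately_periodic
       (fun n => eval3 (subgraph_poly (complete n)) (Posz a) (Posz b) (Posz c)) mu
     /\ ultimately_periodic
       (fun n => eval3 (covered_poly (complete n)) (Posz a) (Posz b) (Posz c)) mu)
  /\
  (forall a b c : nat,
     (0 < a)%N -> (0 < b)%N -> (0 < c)%N -> (a * b %| c)%N ->
     forall mu : nat, (0 < mu)%N ->
     ultimately_periodic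
       (fun n => eval3 (edge_elim_poly (complete n)) (Posz a) (Posz b) (Posz c)) mu).
Proof.
split=> [a b c mu _ _ _ mu_gt0 | a b c _ _ _ /dvdnP[d ->] mu mu_gt0].
  split; last exact: covered_poly_periodic.
  apply: eq_ultimately_periodic.
    by move=> n; rewrite subgraph_poly_colourings.
  exact: colour_sum_ultimately_periodic.
(* Divisibility makes the third argument [1 + d] of the covered components polynomial a natural
   number, as the number of colours must be. *)
apply: eq_ultimately_periodic (covered_poly_periodic a b d.+1 mu_gt0) => n.
by rewrite mulnC !PoszM edge_elim_poly_covered.
Qed.
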